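(* For every Schwartz function $\varphi\in\mathcal{S}(\mathbb{R})$ and every $x\in\mathbb{R}$, $$\mathcal{I}[\varphi](x)=C_{\mathcal{I}}\int_{-\infty}^0\frac{\varphi(x+z)-\varphi(x)-\varphi'(x)z}{|z|^{7/3}}\,dz,\qquad\text{with } C_{\mathcal{I}}=\frac49 .$$
   Context: For $\varphi\in\mathcal{S}(\mathbb{R})$ and $x\in\mathbb{R}$, $\mathcal{I}[\varphi](x):=\int_0^{+\infty}|\zeta|^{-1/3}\varphi''(x-\zeta)\,d\zeta$. *)

(* Defs.v *)
From HB Require Import structures.
From mathcomp Require Import all_boot all_order all_algebra.
From mathcomp Require Import all_classical all_reals all_analysis.

Set Implicit Arguments.
Unset Strict Implicit.
Unset Printing Implicit Defensive.

Import Order.TTheory GRing.Theory Num.Theory.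
Import numFieldNormedType.Exports.

Local Open Scope classical_set_scope.
Local Open Scope ring_scope.

(* [derive1n n f] is a total function, so smoothness (derivability of every iterated
   derivative at every point) has to be required explicitly. *)
Definition schwartz (R : realType) (f : R -> R) : Prop :=
  (forall (n : nat) (x : R), derivable (derive1n n f) x 1) /\
  (forall m n : nat, exists C : R, forall x : R, `|x ^+ m * derive1n n f x| <= C).

Definition fowler_integrand (R : realType) (phi : R -> R) (x zeta : R) : R :=
  `|zeta| `^ (- (1 / 3)) * derive1n 2 phi (x - zeta).

(* Lebesgue integral; the endpoint 0, where the kernel is singular, is left
   out of the domain (it is a null set). *)
Definition fowler (R : realType) (phi : R -> R) (x : R) : R :=
  (\int[@lebesgue_measure R]_(zeta in `]0%R, +oo[) fowler_integrand phi x zeta)%R.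

Definition taylor_integrand (R : realType) (phi : R -> R) (x z : R) : R :=
  (phi (x + z) - phi x - derive1 phi x * z) / `|z| `^ (7 / 3).

(* Main.v *)
Require Import Defs.
From mathcomp Require Import all_boot all_order all_algebra.
From mathcomp Require Import all_classical all_reals all_analysis.
From mathcomp Require Import measurable_realfun.
From mathcomp Require Import ring lra.

Import Order.TTheory GRing.Theory Num.Theory.
Import numFieldNormedType.Exports.

Local Open Scope classical_set_scope.
Local Open Scope ring_scope.

(** The substitution z = - t moves both integrals to the half-line t > 0.  Put
    g(t) = phi(x - t) - phi(x) + phi'(x) t, so that g(0) = g'(0) = 0 and
    g''(t) = phi''(x - t).  Two integrations by parts turn the integral of
    t^(-1/3) g'' into 1/3 * 4/3 = 4/9 times that of t^(-7/3) g.  They are done in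
    one step: the function

      H(t) = t^(-1/3) g'(t) + (1/3) t^(-4/3) g(t)

    has derivative t^(-1/3) g''(t) - (4/9) t^(-7/3) g(t), and it tends to 0 at both
    ends, because g = O(t^2) and g' = O(t) near 0 while g = O(t) and g' = O(1)
    near infinity.  The fundamental theorem of calculus on the half-line
    ([integrable_FTC_halfline]) then says that the two integrals agree
    ([halfline_identity]).

    Both integrands are O(t^(-1/3)) near 0 and O(t^(-4/3)) near infinity.  The
    integrability at the two ends is obtained at once by comparison with a single
    function having exactly these orders and an explicit bounded primitive
    ([majorant_integrable]).

    All fractional powers are written as powers of s = t^(1/3), with s^3 = t, so
    that the computations are rational in s. *)

(** * Lebesgue integrals over the open half-line *)

(** The shift by 2 keeps the lower endpoint strictly below the upper one, also
    for n = 0. *)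
Definition exhaust (R : realType) (n : nat) : set R := `[n.+2%:R^-1, n.+2%:R].

Lemma exhaust_lt (R : realType) (n : nat) : n.+2%:R^-1 < n.+2%:R :> R.
Proof. by rewrite (@lt_trans _ _ 1)// ?invf_lt1 ?ltr1n// ltr0n. Qed.

Lemma exhaust_gt0 (R : realType) (n : nat) (t : R) : exhaust R n t -> 0 < t.
Proof.
by rewrite /exhaust /= in_itv/= => /andP[+ _]; apply: lt_le_trans; rewrite invr_gt0.
Qed.

Lemma exhaust_cvg (R : realType) (t : R) : 0 < t ->
  \forall n \near \oo, exhaust R n t.
Proof.
move=> t0; near=> n; rewrite /exhaust /= in_itv/=; apply/andP; split.
  rewrite invf_ple ?posrE// (@le_trans _ _ n%:R)//; last first.
    by rewrite ler_nat -addn2 leq_addr.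
  by near: n; exact: nbhs_infty_ger.
rewrite (@le_trans _ _ n%:R)//; last by rewrite ler_nat -addn2 leq_addr.
by near: n; exact: nbhs_infty_ger.
Unshelve. all: by end_near. Qed.

Lemma nondecreasing_exhaust (R : realType) : nondecreasing_seq (@exhaust R).
Proof.
move=> m n mn; rewrite subsetEset /exhaust => t /=; rewrite !in_itv/= => /andP[mt tm].
apply/andP; split; last by rewrite (le_trans tm)// ler_nat !ltnS.
by rewrite (le_trans _ mt)// lef_pV2 ?posrE// ler_nat !ltnS.
Qed.

Lemma bigcup_exhaust (R : realType) : \bigcup_n exhaust R n = `]0%R, +oo[%classic.
Proof.
apply/seteqP; split => t /=.
  by move=> [n _ /exhaust_gt0]; rewrite in_itv/= andbT.
rewrite in_itv/= andbT => /exhaust_cvg[n _ /(_ n (leqnn n))]; by exists n.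
Qed.

Section halfline.
Context (R : realType) (f F : R -> R).
Notation mu := (@lebesgue_measure R).
Context (cf : forall t : R, 0 < t -> {for t, continuous f}).
Context (dF : forall t : R, 0 < t -> is_derive t 1 F (f t)).

Lemma measurable_halfline : measurable_fun `](0 : R), +oo[ f.
Proof.
apply: open_continuous_measurable_fun => // t; rewrite inE/= in_itv/= andbT.
exact: cf.
Qed.

Lemma integral_exhaust (n : nat) :
  (\int[mu]_(t in exhaust R n) (f t)%:E = (F n.+2%:R - F n.+2%:R^-1)%:E)%E.
Proof.
have cF (t : R) : 0 < t -> {for t, continuous F}.
  by move=> /dF[dFt _]; apply/differentiable_continuous/derivable1_diffP.
rewrite /exhaust (@continuous_FTC2 _ f F) ?exhaust_lt//.
- apply: continuous_in_subspaceT => t; rewrite inE => /(@exhaust_gt0 R n) t0.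
  exact: cf.
- split.
  + move=> t; rewrite in_itv/= => /andP[+ _] => /(lt_trans _) t0.
    by have [] : is_derive t 1 F (f t) by apply: dF; apply: t0; rewrite invr_gt0.
  + by apply: cvg_at_right_filter; apply: cF; rewrite invr_gt0.
  + by apply: cvg_at_left_filter; exact: cF.
- move=> t; rewrite in_itv/= => /andP[+ _] => /(lt_trans _) t0.
  have [_] : is_derive t 1 F (f t) by apply: dF; apply: t0; rewrite invr_gt0.
  by rewrite derive1E.
Qed.

(** By monotone convergence, the integral is the limit of the increments of F
    over the exhausting segments, which never exceed 2 M. *)
Lemma integrable_ge0_bounded_primitive (M : R) :
  (forall t : R, 0 < t -> 0 <= f t) -> (forall t : R, 0 < t -> `|F t| <= M) ->
  mu.-integrable `]0%R, +oo[ (EFin \o f).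
Proof.
move=> f0 FM; apply/integrableP; split.
  by apply/measurable_EFinP; exact: measurable_halfline.
under eq_integral => t.
  rewrite inE/= in_itv/= andbT => t0; rewrite ger0_norm ?f0//; over.
have cvgf : (\int[mu]_(t in exhaust R n) (f t)%:E @[n --> \oo] -->
             \int[mu]_(t in `]0%R, +oo[) (f t)%:E)%E.
  rewrite -bigcup_exhaust; apply: ge0_nondecreasing_set_cvg_integral.
  - exact: nondecreasing_exhaust.
  - by move=> n; exact: measurable_itv.
  - move=> n; apply/measurable_EFinP; apply: measurable_funS measurable_halfline => //.
    by rewrite -bigcup_exhaust; exact: bigcup_sup.
  - by move=> n t /exhaust_gt0 t0; rewrite lee_fin f0.
apply: (@le_lt_trans _ _ (M + M)%:E); last by rewrite ltry.
rewrite -(cvg_lim _ cvgf)//; apply: lime_le.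
  by apply/cvg_ex; eexists; exact: cvgf.
apply: nearW => n; rewrite integral_exhaust lee_fin.
rewrite (le_trans (ler_norm _))// (le_trans (ler_normB _ _))// lerD// FM//.
Qed.

(** The integrand may change sign: integrability lets dominated convergence, with
    |f| as the bound, pass from the exhausting segments to the half-line. *)
Lemma integrable_FTC_halfline (a b : R) :
  mu.-integrable `]0%R, +oo[ (EFin \o f) ->
  F t @[t --> 0^'+] --> a -> F t @[t --> +oo] --> b ->
  \int[mu]_(t in `]0%R, +oo[) f t = b - a.
Proof.
move=> intf Fa Fb.
have sub n : exhaust R n `<=` `]0%R, +oo[.
  by rewrite -bigcup_exhaust; exact: bigcup_sup.
have mE n : measurable (exhaust R n) by exact: measurable_itv.
have cvgf : (\int[mu]_(t in exhaust R n) (f t)%:E @[n --> \oo] -->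
             \int[mu]_(t in `]0%R, +oo[) (f t)%:E)%E.
  have eqr n : (\int[mu]_(t in exhaust R n) (f t)%:E =
       \int[mu]_(t in `]0%R, +oo[) (((EFin \o f) \_ (exhaust R n)) t))%E.
    by rewrite -integral_mkcondr setIidr.
  under eq_fun do rewrite eqr.
  have [] // := @dominated_convergence _ _ _ mu _ (measurable_itv `](0 : R), +oo[)
    (fun n => (EFin \o f) \_ (exhaust R n)) (EFin \o f) (abse \o (EFin \o f)).
  - move=> n; apply/measurable_restrict => //; first exact: measurable_itv.
    rewrite setIidr//; apply/measurable_EFinP.
    exact: measurable_funS measurable_halfline.
  - by apply/measurable_EFinP; exact: measurable_halfline.
  - apply: aeW => t /=; rewrite in_itv/= andbT => /exhaust_cvg tE.
    apply: cvg_near_cst; near=> n.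
    by rewrite patchE mem_set//; near: n.
  - exact: integrable_abse.
  - apply: aeW => t n _ /=; rewrite patchE; case: ifPn => // _.
    by rewrite abse0 lee_fin.
have nat_cvg : n.+2%:R @[n --> \oo] --> (+oo : set_system R).
  by have := @cvgr_idn R; rewrite -(@cvg_shiftn 2); under eq_fun do rewrite addn2.
have cvgF : (F n.+2%:R - F n.+2%:R^-1)%:E @[n --> \oo] --> (b - a)%:E.
  apply: cvg_EFin; first exact: nearW.
  apply: cvgB.
    by move/cvg_pinftyP : Fb; apply.
  move/cvg_at_rightP : Fa; apply; split=> [n|]; first by rewrite invr_gt0.
  by apply/gtr0_cvgV0 => //; exact: nearW.
rewrite /Rintegral.
suff -> : (\int[mu]_(t in `]0%R, +oo[) (f t)%:E = (b - a)%:E)%E by [].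
rewrite -(cvg_lim _ cvgf)//; apply: cvg_lim => //.
by under eq_fun do rewrite integral_exhaust.
Unshelve. all: by end_near. Qed.

End halfline.

(** * The cube root and its derivatives *)

Definition cbrt (R : realType) (t : R) : R := t `^ 3^-1.

Lemma cbrt_gt0 (R : realType) (t : R) : 0 < t -> 0 < cbrt R t.
Proof. exact: powR_gt0. Qed.

Lemma powR_third (R : realType) (t : R) (n : nat) :
  t `^ (n%:R / 3) = cbrt R t ^+ n.
Proof. by rewrite mulrC powRrM powR_mulrn// powR_ge0. Qed.

Lemma cbrtK (R : realType) (t : R) : 0 < t -> cbrt R t ^+ 3 = t.
Proof. by move=> t0; rewrite -powR_third divff// powRr1// ltW. Qed.

Lemma is_derive_cbrt (R : realType) (t : R) : 0 < t ->
  is_derive t 1 (@cbrt R) (3 * cbrt R t ^+ 2)^-1.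
Proof.
move=> t0; apply: is_derive_eq; first exact: is_derive1_powR.
rewrite (_ : 3^-1 - 1 = - (2%:R / 3)); last by lra.
by rewrite powRN powR_third [RHS]invfM.
Qed.

Lemma continuous_cbrt (R : realType) (t : R) : 0 < t ->
  {for t, continuous (@cbrt R)}.
Proof.
move=> /is_derive_cbrt[d _].
exact/differentiable_continuous/derivable1_diffP.
Qed.

Lemma cvg_cbrt0 (R : realType) : cbrt R t @[t --> 0^'+] --> 0.
Proof. exact: powR_cvg0. Qed.

Lemma cvg_cbrty (R : realType) : cbrt R t @[t --> +oo] --> +oo.
Proof.
apply/cvgryPge => A; near=> t.
have t0 : 0 < t by near: t; exact: nbhs_pinfty_gt.
rewrite leNgt; apply/negP => cA.
have : t < A ^+ 3.
  by rewrite -[ltLHS](cbrtK R t t0) ltrXn2r// ltW// cbrt_gt0.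
by apply/negP; rewrite -leNgt; near: t; apply: nbhs_pinfty_ge; exact: num_real.
Unshelve. all: by end_near. Qed.

(** The pointwise form, whose conclusion unifies with explicit lambda-terms. *)
Lemma is_derive_mulf (R : realType) (f g : R -> R) (x a b : R) :
  is_derive x 1 f a -> is_derive x 1 g b ->
  is_derive x 1 (fun t => f t * g t) (f x * b + g x * a).
Proof. by move=> fa gb; exact: is_deriveM. Qed.

Lemma is_derive_cbrtV (R : realType) (n : nat) (t : R) : 0 < t ->
  is_derive t 1 (fun u => (cbrt R u ^+ n)^-1) (- n%:R / (3 * cbrt R t ^+ n.+3)).
Proof.
move=> t0; have c0 := cbrt_gt0 R t t0.
have dc := is_derive_cbrt R t t0.
have cn : (@cbrt R ^+ n) t != 0 by rewrite exprfctE gt_eqF// exprn_gt0.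
have := is_deriveV cn (is_deriveX n dc).
rewrite exprfctE => dV; apply: (is_derive_eq dV).
case: n cn dV => [|n] cn _.
  by rewrite mulr0n !(mul0r, scale0r, scaler0, oppr0).
rewrite /GRing.scale/= !exprS; field.
by rewrite expf_neq0 gt_eqF.
Qed.

(** * A common integrable bound *)

(** The difference of the two sides is 3 (1 - s)^2 (1 + s).  With s^3 = t, the
    inequality reduces a bound against [majorant] to one against 1 + t. *)
Lemma one_plus_cube_le (R : realType) (s : R) : 0 < s ->
  (1 + s) ^+ 3 <= 4 * (1 + s ^+ 3).
Proof.
move=> s0; rewrite -subr_ge0.
have -> : 4 * (1 + s ^+ 3) - (1 + s) ^+ 3 = 3 * (1 - s) ^+ 2 * (1 + s) by ring.
by apply: mulr_ge0; [apply: mulr_ge0 => //; exact: sqr_ge0|lra].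
Qed.

(** This is the derivative of (s / (1 + s))^2 for s = t^(1/3). *)
Definition majorant (R : realType) (t : R) : R :=
  2 / 3 / (cbrt R t * (1 + cbrt R t) ^+ 3).

Lemma majorant_ge0 (R : realType) (t : R) : 0 < t -> 0 <= majorant R t.
Proof.
move=> /cbrt_gt0 s0; rewrite /majorant !divr_ge0// mulr_ge0 ?ltW//.
by rewrite exprn_gt0// addr_gt0.
Qed.

Lemma majorant_integrable (R : realType) :
  (@lebesgue_measure R).-integrable `]0%R, +oo[ (EFin \o @majorant R).
Proof.
(* s / (1 + s) written with a single occurrence of s *)
pose G (t : R) := (1 - (1 + cbrt R t)^-1) ^+ 2.
have c1 (t : R) : 0 < t -> 1 + cbrt R t != 0.
  by move=> /cbrt_gt0 s0; rewrite gt_eqF// addr_gt0.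
apply: (@integrable_ge0_bounded_primitive R _ G _ _ 1).
- move=> t t0; have s0 := cbrt_gt0 R t t0.
  apply: cvgM; first exact: cvg_cst.
  apply: cvgV; first by rewrite mulf_neq0 ?expf_neq0 ?c1 ?gt_eqF.
  have cc := continuous_cbrt R t t0.
  apply: cvgM => //.
  apply: (@continuous_comp _ _ _ (fun u => 1 + cbrt R u) (fun u => u ^+ 3));
    last exact: exprn_continuous.
  by apply: cvgD => //; exact: cvg_cst.
- move=> t t0; have s0 := cbrt_gt0 R t t0.
  have dc := is_derive_cbrt R t t0.
  have d1 : is_derive t 1 (cst 1 + @cbrt R) (0 + (3 * cbrt R t ^+ 2)^-1).
    exact: is_deriveD.
  have dV := @is_deriveV R (cst 1 + @cbrt R) t _ 1 (c1 t t0) d1.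
  have := is_deriveX 2 (is_deriveB (is_derive_cst (1 : R) t (1 : R)) dV).
  move=> dX; apply: (is_derive_eq dX).
  rewrite /majorant /GRing.scale /= /cst !fctE; field.
  by rewrite c1// gt_eqF.
- by move=> t; exact: majorant_ge0.
- move=> t /cbrt_gt0 s0.
  have : 0 < (1 + cbrt R t)^-1 <= 1.
    by rewrite invr_gt0 invf_le1 ?addr_gt0// lerDl ltW.
  rewrite /G; set u := (_^-1) => /andP[u0 u1].
  by rewrite ger0_norm ?sqr_ge0// expr_le1//; lra.
Qed.

Lemma integrable_majorated (R : realType) (f : R -> R) (C : R) :
  (forall t : R, 0 < t -> {for t, continuous f}) ->
  (forall t : R, 0 < t -> `|f t| <= C * majorant R t) ->
  (@lebesgue_measure R).-integrable `]0%R, +oo[ (EFin \o f).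
Proof.
move=> cf fC.
apply: le_integrable (integrableZl _ C (majorant_integrable R)) => //.
  by apply/measurable_EFinP; exact: measurable_halfline.
move=> t /=; rewrite in_itv/= andbT lee_fin => /fC/le_trans; apply.
exact: ler_norm.
Qed.

(** * The identity on the half-line *)

Lemma norm_le_of_derive_le (R : realType) (h h1 : R -> R) (M t : R) :
  (forall u : R, is_derive u 1 h (h1 u)) -> h 0 = 0 -> 0 < t ->
  (forall u : R, 0 < u < t -> `|h1 u| <= M) -> `|h t| <= M * t.
Proof.
move=> dh h0 t0 h1M.
have ch : {within `[0, t], continuous h}.
  by apply: derivable_within_continuous => u _; have [] := dh u.
have [c] := MVT t0 (fun u _ => dh u) ch.
rewrite in_itv/= => /h1M cM; rewrite h0 !subr0 => ->.
by rewrite normrM (gtr0_norm t0) ler_pM2r.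
Qed.

(** The bound M1 controls g and g' at infinity and M2 controls them near 0; M3
    gives the decay of g'' that makes t^(-1/3) g'' integrable at infinity. *)
Lemma halfline_identity (R : realType) (g g1 g2 : R -> R) (M1 M2 M3 : R) :
  (forall t : R, is_derive t 1 g (g1 t)) ->
  (forall t : R, is_derive t 1 g1 (g2 t)) -> continuous g2 ->
  g 0 = 0 -> g1 0 = 0 ->
  (forall t : R, 0 < t -> `|g1 t| <= M1) ->
  (forall t : R, 0 < t -> `|g2 t| <= M2) ->
  (forall t : R, 0 < t -> t * `|g2 t| <= M3) ->
  [/\ (@lebesgue_measure R).-integrable `]0%R, +oo[
        (EFin \o (fun t => (cbrt R t)^-1 * g2 t)),
      (@lebesgue_measure R).-integrable `]0%R, +oo[
        (EFin \o (fun t => g t / cbrt R t ^+ 7)) &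
      (\int[@lebesgue_measure R]_(t in `]0%R, +oo[) ((cbrt R t)^-1 * g2 t) =
      4 / 9 * \int[@lebesgue_measure R]_(t in `]0%R, +oo[) (g t / cbrt R t ^+ 7))%R].
Proof.
move=> dg dg1 cg2 g0 g10 g1M g2M tg2M.
have cg : continuous g.
  by move=> t; apply/differentiable_continuous/derivable1_diffP; have [] := dg t.
have cV n (t : R) : 0 < t -> {for t, continuous (fun u => (cbrt R u ^+ n)^-1)}.
  move=> t0; apply/differentiable_continuous/derivable1_diffP.
  by have [] := is_derive_cbrtV R n t t0.
have M20 : 0 <= M2 by exact: le_trans (g2M _ ltr01).
have g1t (t : R) : 0 < t -> `|g1 t| <= M2 * t.
  by move=> t0; apply: (norm_le_of_derive_le R g1 g2) => // u /andP[u0 _]; exact: g2M.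
have gt2 (t : R) : 0 < t -> `|g t| <= M2 * t ^+ 2.
  move=> t0; rewrite expr2 mulrA;
  apply: (norm_le_of_derive_le R g g1) => // u /andP[u0 ut].
  by rewrite (le_trans (g1t u u0))// ler_wpM2l// ltW.
have gt1 (t : R) : 0 < t -> `|g t| <= M1 * t.
  by move=> t0; apply: (norm_le_of_derive_le R g g1) => // u /andP[u0 _]; exact: g1M.
pose fw t := (cbrt R t)^-1 * g2 t; pose tl t := g t / cbrt R t ^+ 7.
have cfw (t : R) : 0 < t -> {for t, continuous fw}.
  by move=> t0; apply: cvgM; [exact: (cV 1%N t t0)|exact: cg2].
have ctl (t : R) : 0 < t -> {for t, continuous tl}.
  by move=> t0; apply: cvgM; [exact: cg|exact: (cV 7%N t t0)].
have ifw : (@lebesgue_measure R).-integrable `]0%R, +oo[ (EFin \o fw).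
  apply: (integrable_majorated R fw (6 * (M2 + M3))) => // t t0.
  have s0 := cbrt_gt0 R t t0; have := g2M t t0; have := tg2M t t0.
  rewrite /fw /majorant normrM gtr0_norm ?invr_gt0//.
  move=> A1 A2.
  set s := cbrt R t in s0 *.
  have s3 : 0 < (1 + s) ^+ 3 by rewrite exprn_gt0// addr_gt0.
  have -> : 6 * (M2 + M3) * (2 / 3 / (s * (1 + s) ^+ 3)) =
      s^-1 * (4 * (M2 + M3)) / (1 + s) ^+ 3.
    by field; rewrite !gt_eqF// addr_gt0.
  rewrite ler_pdivlMr//.
  rewrite -mulrA; apply: ler_wpM2l; first by rewrite invr_ge0 ltW.
  rewrite (@le_trans _ _ (`|g2 t| * (4 * (1 + t))))//.
    by rewrite ler_wpM2l// -[t](cbrtK R t t0) one_plus_cube_le.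
  lra.
have itl : (@lebesgue_measure R).-integrable `]0%R, +oo[ (EFin \o tl).
  apply: (integrable_majorated R tl (6 * (M1 + M2))) => // t t0.
  have s0 := cbrt_gt0 R t t0; have := gt1 t t0; have := gt2 t t0.
  rewrite /tl /majorant normrM normfV (gtr0_norm (exprn_gt0 7 s0)).
  move=> A2 A1.
  have s3 : 0 < (1 + cbrt R t) ^+ 3 by rewrite exprn_gt0// addr_gt0.
  have -> : 6 * (M1 + M2) * (2 / 3 / (cbrt R t * (1 + cbrt R t) ^+ 3)) =
      4 * (M1 + M2) * t ^+ 2 / cbrt R t ^+ 7 / (1 + cbrt R t) ^+ 3.
    rewrite -[t in t ^+ 2](cbrtK R t t0).
    by field; rewrite !gt_eqF// addr_gt0.
  rewrite ler_pdivlMr//.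
  rewrite mulrAC; apply: ler_wpM2r; first by rewrite invr_ge0 exprn_ge0// ltW.
  rewrite (@le_trans _ _ (`|g t| * (4 * (1 + t))))//.
    by rewrite ler_wpM2l// -[in leRHS](cbrtK R t t0) one_plus_cube_le.
  have : t * `|g t| <= t * (M1 * t) by rewrite ler_wpM2l// ltW.
  rewrite expr2 in A2 *; lra.
split => //.
(* the boundary term of the two integrations by parts *)
pose H t := g1 t * (cbrt R t ^+ 1)^-1 + 3^-1 * (g t * (cbrt R t ^+ 4)^-1).
have dH (t : R) : 0 < t -> is_derive t 1 H (fw t - 4 / 9 * tl t).
  move=> t0; have s0 := cbrt_gt0 R t t0.
  have d1 := is_derive_mulf R _ _ _ _ _ (dg1 t) (is_derive_cbrtV R 1 t t0).
  have d2 := is_derive_mulf R _ _ _ _ _ (dg t) (is_derive_cbrtV R 4 t t0).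
  have d3 := is_deriveD d1 (is_derive_mulf R _ _ _ _ _
    (is_derive_cst (3^-1 : R) t (1 : R)) d2).
  apply: (is_derive_eq d3); rewrite /fw /tl /cst.
  by field; rewrite gt_eqF.
(* near 0, |g'| / s <= M2 t / s = M2 s^2 and |g| / s^4 <= M2 t^2 / s^4 = M2 s^2 *)
have H0 : H t @[t --> 0^'+] --> 0.
  apply: norm_cvg0.
  apply: (@squeeze_cvgr _ _ _ _ (cst 0) (fun t => 4 / 3 * M2 * cbrt R t ^+ 2)).
  - near=> t; rewrite normr_ge0/=.
    have t0 : 0 < t by near: t; exact: nbhs_right_gt.
    have s0 := cbrt_gt0 R t t0.
    rewrite /H (le_trans (ler_normD _ _))// !normrM !normfV.
    have n0 n : `|cbrt R t ^+ n| = cbrt R t ^+ n by rewrite gtr0_norm// exprn_gt0.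
    rewrite !n0 [`|3|]gtr0_norm// expr1.
    have e1 : `|g1 t| / cbrt R t <= M2 * cbrt R t ^+ 2.
      by rewrite ler_pdivrMr// -mulrA -exprSr cbrtK// g1t.
    have e2 : `|g t| / cbrt R t ^+ 4 <= M2 * cbrt R t ^+ 2.
      by rewrite ler_pdivrMr ?exprn_gt0// -mulrA -exprD (exprM _ 3 2) cbrtK// gt2.
    lra.
  - exact: cvg_cst.
  - have := cvgM (cvg_cst (4 / 3 * M2)) (cvgM (cvg_cbrt0 R) (cvg_cbrt0 R)).
    by rewrite !mulr0; apply.
(* near infinity, |g'| / s <= M1 / s and |g| / s^4 <= M1 t / s^4 = M1 / s *)
have Hy : H t @[t --> +oo] --> 0.
  apply: norm_cvg0.
  apply: (@squeeze_cvgr _ _ _ _ (cst 0) (fun t => 4 / 3 * M1 * (cbrt R t)^-1)).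
  - near=> t; rewrite normr_ge0/=.
    have t0 : 0 < t by near: t; exact: nbhs_pinfty_gt.
    have s0 := cbrt_gt0 R t t0.
    rewrite /H (le_trans (ler_normD _ _))// !normrM !normfV.
    have n0 n : `|cbrt R t ^+ n| = cbrt R t ^+ n by rewrite gtr0_norm// exprn_gt0.
    rewrite !n0 [`|3|]gtr0_norm// expr1.
    have e1 : `|g1 t| / cbrt R t <= M1 / cbrt R t.
      by rewrite ler_pM2r ?invr_gt0// g1M.
    have e2 : `|g t| / cbrt R t ^+ 4 <= M1 / cbrt R t.
      rewrite ler_pdivrMr ?exprn_gt0// -mulrA exprS mulKf ?gt_eqF//.
      by rewrite cbrtK// gt1.
    lra.
  - exact: cvg_cst.
  - rewrite -[X in _ --> X](mulr0 (4 / 3 * M1)); apply: cvgM; first exact: cvg_cst.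
    apply/gtr0_cvgV0; last exact: cvg_cbrty.
    by near=> t; apply: cbrt_gt0; near: t; exact: nbhs_pinfty_gt.
have i4 : (@lebesgue_measure R).-integrable `]0%R, +oo[ (EFin \o (fun t => 4 / 9 * tl t)).
  exact: (integrableZl _ (4 / 9) itl).
(* H has limit 0 at both ends, so the integral of H' vanishes *)
have := @integrable_FTC_halfline R (fun t => fw t - 4 / 9 * tl t) H _ dH 0 0 _ H0 Hy.
rewrite subrr RintegralB// RintegralZl// => E.
apply/eqP; rewrite -subr_eq0; apply/eqP/E.
  move=> t t0; apply: cvgB; first exact: cfw.
  by apply: cvgM; [exact: cvg_cst|exact: ctl].
exact: (integrableB _ ifw i4).
Unshelve. all: by end_near. Qed.

(** * Reflection and conclusion *)

(** Lebesgue measure is its own image under negation, so this is the change of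
    variables along a pushforward measure. *)
Lemma reflection_halfline (R : realType) (f : R -> R) :
  measurable_fun [set: R] f ->
  (@lebesgue_measure R).-integrable `]0%R, +oo[ (EFin \o (f \o -%R)) ->
  (@lebesgue_measure R).-integrable `]-oo, 0%R[ (EFin \o f) /\
  (\int[@lebesgue_measure R]_(z in `]-oo, 0%R[) f z =
   \int[@lebesgue_measure R]_(t in `]0%R, +oo[) f (- t))%R.
Proof.
move=> mf intf.
have mEf : measurable_fun [set: R] (EFin \o f) by exact/measurable_EFinP.
have preN : (-%R : measurableTypeR R -> measurableTypeR R) @^-1` `]-oo, 0%R[ =
    `]0%R, +oo[%classic.
  by apply/seteqP; split => t /=; rewrite !in_itv/= andbT oppr_lt0.
have mN : measurable_fun [set: measurableTypeR R]
    (-%R : measurableTypeR R -> measurableTypeR R) by exact: measurable_funN.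
have eqN (h : R -> \bar R) :
    (\int[@lebesgue_measure R]_(z in `]-oo, 0%R[) h z =
     \int[pushforward (@lebesgue_measure R)
       (-%R : measurableTypeR R -> measurableTypeR R)]_(z in `]-oo, 0%R[) h z)%E.
  by apply: eq_measure_integral => A mA _; exact/esym/lebesgue_measureN.
have intf' : (@lebesgue_measure R).-integrable
    ((-%R : measurableTypeR R -> measurableTypeR R) @^-1` `]-oo, 0%R[)
    ((EFin \o f) \o -%R) by rewrite preN.
split; last first.
  rewrite /Rintegral eqN (integral_pushforward mN mEf intf')//.
  by rewrite preN.
have /integrableP[_ foo] := integrable_pushforward mN mEf intf' (measurable_itv _).
apply/integrableP; split; first exact: measurable_funTS.
by rewrite eqN.
Qed.

Lemma measurable_taylor_integrand (R : realType) (phi : R -> R) (x : R) :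
  continuous phi -> measurable_fun [set: R] (taylor_integrand phi x).
Proof.
move=> cphi; rewrite (_ : taylor_integrand phi x = fun z =>
  (phi (x + z) - phi x - derive1 phi x * z) * (`|z| `^ (- (7 / 3)))); last first.
  by apply/funext => z; rewrite /taylor_integrand powRN.
apply: measurable_funM.
  apply: continuous_measurable_fun => z.
  apply: cvgB; last by apply: cvgM; [exact: cvg_cst|exact: cvg_id].
  apply: cvgB; last exact: cvg_cst.
  apply: (@continuous_comp _ _ _ (fun z => x + z) phi); last exact: cphi.
  by apply: cvgD; [exact: cvg_cst|exact: cvg_id].
apply: (@measurableT_comp _ _ _ _ _ _ (@powR R ^~ (- (7 / 3)))).
  exact: measurable_powR.
exact: normr_measurable.
Qed.

Lemma is_derive_reflected_shift (R : realType) (f : R -> R) (x t : R) :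
  derivable f (x - t) 1 ->
  is_derive t 1 (fun u => f (x - u)) (- derive1 f (x - t)).
Proof.
move=> df.
have d1 : is_derive (x - t) 1 f (derive1 f (x - t)).
  by rewrite derive1E; exact/derivableP.
have d2 : is_derive t 1 (cst x - id) (0 - 1 : R) by exact: is_deriveB.
have := @is_derive1_comp R f (cst x - id) t _ _ d1 d2.
by move=> d; apply: (is_derive_eq d); rewrite sub0r mulrN1.
Qed.

(* The real-valued integral [Rintegral] is total, so the two integrability
   clauses record that both integrals exist as Lebesgue integrals. *)
Theorem proposition2 (R : realType) (phi : R -> R) (x : R) :
  schwartz phi ->
  [/\ (@lebesgue_measure R).-integrable `]0%R, +oo[
        (EFin \o fowler_integrand phi x),
      (@lebesgue_measure R).-integrable `]-oo, 0%R[
        (EFin \o taylor_integrand phi x) &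
      fowler phi x =
        (4 / 9) * (\int[@lebesgue_measure R]_(z in `]-oo, 0%R[)
                     taylor_integrand phi x z)%R].
Proof.
move=> [dphi bphi].
have cphi n : continuous (derive1n n phi).
  by move=> t; apply/differentiable_continuous/derivable1_diffP.
have [M1 b1] := bphi 0%N 1%N; have [M2 b2] := bphi 0%N 2%N.
have [M3 b3] := bphi 1%N 2%N.
pose g t := phi (x - t) - phi x + derive1 phi x * t.
pose g1 t := derive1 phi x - derive1 phi (x - t).
pose g2 t := derive1n 2 phi (x - t).
have dg (t : R) : is_derive t 1 g (g1 t).
  have d1 := is_derive_reflected_shift R phi x t (dphi 0%N _).
  have d2 := is_deriveB d1 (is_derive_cst (phi x) t (1 : R)).
  have d3 := is_derive_mulf R _ _ _ _ _
    (is_derive_cst (derive1 phi x) t (1 : R)) (is_derive_id t (1 : R)).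
  have d4 := is_deriveD d2 d3.
  by apply: (is_derive_eq d4); rewrite /g1 /cst; ring.
have dg1 (t : R) : is_derive t 1 g1 (g2 t).
  have d1 := is_derive_reflected_shift R (derive1 phi) x t (dphi 1%N _).
  have d2 := is_deriveB (is_derive_cst (derive1 phi x) t (1 : R)) d1.
  by apply: (is_derive_eq d2); rewrite sub0r opprK.
have cg2 : continuous g2.
  move=> t; apply: (@continuous_comp _ _ _ (fun u => x - u) (derive1n 2 phi)).
    by apply: cvgB; [exact: cvg_cst|exact: cvg_id].
  exact: cphi.
have e1 y : `|derive1 phi y| <= M1 by have := b1 y; rewrite expr0 mul1r.
have e2 y : `|derive1n 2 phi y| <= M2 by have := b2 y; rewrite expr0 mul1r.
have [||t _|t _|t t0|iF iT eFT] :=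
  halfline_identity R g g1 g2 (M1 + M1) M2 (`|x| * M2 + M3) dg dg1 cg2.
- by rewrite /g subr0 subrr mulr0 addr0.
- by rewrite /g1 subr0 subrr.
- by rewrite (le_trans (ler_normB _ _))// lerD.
- exact: e2.
(* t = x - (x - t), and y phi''(y) is bounded *)
- rewrite -[t in t * _](gtr0_norm t0) -normrM -{1}(subKr x t) mulrBl.
  rewrite (le_trans (ler_normB _ _))// lerD//.
    by rewrite normrM ler_wpM2l// e2.
  by have := b3 (x - t); rewrite expr1.
have EF : {in `](0 : R), +oo[%classic,
    (fun t => (cbrt R t)^-1 * g2 t) =1 fowler_integrand phi x}.
  move=> t; rewrite inE/= in_itv/= andbT => t0.
  by rewrite /fowler_integrand gtr0_norm// powRN mul1r.
have ET : {in `](0 : R), +oo[%classic,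
    (fun t => g t / cbrt R t ^+ 7) =1 taylor_integrand phi x \o -%R}.
  move=> t; rewrite inE/= in_itv/= andbT => t0.
  by rewrite /taylor_integrand/= normrN gtr0_norm// powR_third mulrN opprK.
have [] := reflection_halfline R _ (measurable_taylor_integrand R phi x (cphi 0%N)).
  apply: eq_integrable iT => // t t0; congr EFin; exact: ET.
move=> iT' ->; split => //.
  apply: eq_integrable iF => // t t0; congr EFin; exact: EF.
transitivity (\int[@lebesgue_measure R]_(t in `]0%R, +oo[)
    ((cbrt R t)^-1 * g2 t))%R.
  by apply: eq_Rintegral => t t0; rewrite EF.
rewrite eFT; congr (_ * _); apply: eq_Rintegral => t t0; exact: ET.
Qed.
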